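(* Let $\mathfrak{f}$ be a surface in $\mathbb{RP}^3$ with positive definite projective metric, and let $g_1:\mathbb{D}\to\mathcal{Q}$ be its first-order Gauss map. Then $g_1$ is conformal if and only if $\mathfrak{f}$ is a definite Demoulin surface (that is, $P=0$).
   Context: **Surface and canonical system.** Let $\mathfrak{f}:M\to\mathbb{RP}^3$ be an immersed surface and $f$ a local lift to $\mathbb{R}^4\setminus\{0\}$. Write $D$ for the flat connection of $\mathbb{R}^4$, $\zeta$ for the radial vector field, and $\xi$ for a vector field along $f$ transversal to the span of $\zeta$ and $df(TM)$. The Gauss formula $D_X f_*Y=f_*(\nabla_XY)+h(X,Y)\xi+T(X,Y)\zeta$ defines a symmetric form $h$ whose conformal class $[h]$ (up to sign) depends only on $\mathfrak{f}$. It is assumed that $h$ is definite (positive definite after choosing the sign of $\xi$), and $M$ is a Riemann surface with conformal structure $[h]$. Let $\mathbb{D}\subset M$ be a simply connected (connected) domain with complex coordinate $z$. There is a lift $f:\mathbb{D}\to\mathbb{R}^4\setminus\{0\}$, unique up to a constant factor, satisfying the canonical system $$f_{zz}=b f_{\bar z}+pf,\qquad f_{\bar z\bar z}=\bar b f_z+\bar p f$$ for smooth complex functions $b,p$. The projective metric of $\mathfrak{f}$ is $8|b|^2dz\,d\bar z$. ''Positive definite projective metric'' means that the symmetric form $h$ defined by the Gauss formula $D_X f_*Y=f_*(\nabla_XY)+h(X,Y)\xi+T(X,Y)\zeta$ is definite (positive definite after choosing the sign of $\xi$) and $b$ vanishes nowhere. All objects below are considered on $\mathbb{D}$. **Invariants.**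 Set $$k=\tfrac12\left(|b|^2-(\log b)_{z\bar z}\right),\qquad P=p+\frac{b_{\bar z}}{2}-\frac{\bar b_{zz}}{2\bar b}+\frac{\bar b_z^2}{4\bar b^2}.$$ The surface is a *definite Demoulin surface* if $P=0$ identically. **Wilczynski frame.** It is $F=(f,f_1,f_2,\eta)$ with $f_1=f_z-\frac{\bar b_z}{2\bar b}f$, $f_2=f_{\bar z}-\frac{b_{\bar z}}{2b}f$, $\eta=f_{z\bar z}-\frac{\bar b_z}{2\bar b}f_{\bar z}-\frac{b_{\bar z}}{2b}f_z+\left(\frac{|b_{\bar z}|^2}{4|b|^2}-\frac{|b|^2}{2}\right)f$. It satisfies $F_z=FU$, $F_{\bar z}=FV$ with $$U=\begin{pmatrix}\frac{\bar b_z}{2\bar b}&P&k&b\bar P\\1&-\frac{\bar b_z}{2\bar b}&0&k\\0&b&\frac{\bar b_z}{2\bar b}&P\\0&0&1&-\frac{\bar b_z}{2\bar b}\end{pmatrix},\qquad V=\begin{pmatrix}\frac{b_{\bar z}}{2b}&\bar k&\bar P&\bar bP\\0&\frac{b_{\bar z}}{2b}&\bar b&\bar P\\1&0&-\frac{b_{\bar z}}{2b}&\bar k\\0&1&0&-\frac{b_{\bar z}}{2b}\end{pmatrix}.$$ From now on $F$ denotes the solution of $F_z=FU$, $F_{\bar z}=FV$ normalized by $F(z_* )=\mathrm{id}$ at a base point $z_*\in\mathbb{D}$ (this changes the frame by left multiplication by a constant matrix). With $$L=\frac1{\sqrt2}\begin{pmatrix}\sqrt2&0&0&0\\0&\sqrt{-1}&-\sqrt{-1}&0\\0&1&1&0\\0&0&0&\sqrt2\end{pmatrix},$$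 the matrix $\hat F=LFL^{-1}$ takes values in $\mathrm{SL}_4\mathbb{R}$. **Target space and Gauss map.** Let $$\hat J_1=\begin{pmatrix}0&0&0&1\\0&1&0&0\\0&0&1&0\\1&0&0&0\end{pmatrix}=LJ_1L^{\mathrm T},$$ where $J_1$ is the $4\times4$ antidiagonal matrix with all antidiagonal entries $1$. Let $\mathcal{Q}$ be the space of real symmetric $4\times4$ matrices of determinant $-1$ with three positive and one negative eigenvalue (it parametrizes conformal $2$-spheres in $\mathbb{RP}^3$); it is the orbit of $\hat J_1$ under the $\mathrm{SL}_4\mathbb{R}$-action $(g,Q)\mapsto gQg^{\mathrm T}$. It carries the invariant semi-Riemannian metric $\langle X,Y\rangle_Q=\mathrm{Tr}(Q^{-1}XQ^{-1}Y)$ for $X,Y\in T_Q\mathcal{Q}$. The *first-order Gauss map* is $g_1=\hat F\hat J_1\hat F^{\mathrm T}=LFJ_1F^{\mathrm T}L^{\mathrm T}:\mathbb{D}\to\mathcal{Q}$. **Conformality.** $g_1$ is *conformal* if $\langle\partial_zg_1,\partial_zg_1\rangle=0$ on $\mathbb{D}$, where $\langle\cdot,\cdot\rangle$ is extended complex bilinearly. *)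

(* Defs.v *)
From mathcomp Require Import all_boot all_order all_algebra.
From mathcomp Require Import all_classical all_reals all_analysis.
From mathcomp Require Import complex.

Set Implicit Arguments.
Unset Strict Implicit.
Unset Printing Implicit Defensive.

Import Order.TTheory GRing.Theory Num.Theory.
Import numFieldNormedType.Exports.

Local Open Scope classical_set_scope.
Local Open Scope ring_scope.
Local Open Scope complex_scope.

Section Domain.
Variable R : realType.

(* The complex coordinate identifies the domain with a subset of the plane; a
   point (x, y) : R * R stands for x + iy. *)

Definition loop_in (D : set (R * R)) (c : R -> R * R) : Prop :=
  [/\ {within `[0, 1], continuous c}, forall t : R, t \in `[0, 1] -> D (c t)
    & c 0 = c 1].

Definition contractible_in (D : set (R * R)) (c : R -> R * R) : Prop :=
  exists H : R * R -> R * R,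
    [/\ {within `[0, 1] `*` `[0, 1], continuous H},
        forall s t : R, s \in `[0, 1] -> t \in `[0, 1] -> D (H (s, t)),
        forall t : R, t \in `[0, 1] -> H (0, t) = c t /\ H (1, t) = c 0
      & forall s : R, s \in `[0, 1] -> H (s, 0) = c 0 /\ H (s, 1) = c 0].

Definition simply_connected_domain (D : set (R * R)) : Prop :=
  [/\ open D, connected D & forall c, loop_in D c -> contractible_in D c].

End Domain.

Section Calculus.
Variable R : realType.

(* C^infinity on the open set D: all iterated directional derivatives are
   (totally) differentiable on D. *)
Definition smooth_on (D : set (R * R)) (u : R * R -> R) : Prop :=
  forall (s : seq (R * R)) (z : R * R), D z ->
    differentiable (foldr (fun v w => 'D_v w) u s) z.

Definition csmooth_on (D : set (R * R)) (u : R * R -> R[i]) : Prop :=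
  smooth_on D (fun z => complex.Re (u z)) /\ smooth_on D (fun z => complex.Im (u z)).

Definition mxsmooth_on m n (D : set (R * R)) (A : R * R -> 'M[R]_(m, n)) :=
  forall i j, smooth_on D (fun z => A z i j).

Definition cmxsmooth_on m n (D : set (R * R)) (A : R * R -> 'M[R[i]]_(m, n)) :=
  forall i j, csmooth_on D (fun z => A z i j).

Definition mxdir m n (v : R * R) (A : R * R -> 'M[R]_(m, n)) (z : R * R) :
    'M[R]_(m, n) :=
  \matrix_(i, j) 'D_v (fun w => A w i j) z.

Definition cdir (v : R * R) (u : R * R -> R[i]) (z : R * R) : R[i] :=
  'D_v (fun w => complex.Re (u w)) z +i* 'D_v (fun w => complex.Im (u w)) z.

Definition dz (u : R * R -> R[i]) (z : R * R) : R[i] :=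
  (cdir (1, 0) u z - 'i%C * cdir (0, 1) u z) / 2.

Definition dzbar (u : R * R -> R[i]) (z : R * R) : R[i] :=
  (cdir (1, 0) u z + 'i%C * cdir (0, 1) u z) / 2.

Definition mxdz m n (A : R * R -> 'M[R[i]]_(m, n)) (z : R * R) :
    'M[R[i]]_(m, n) :=
  \matrix_(i, j) dz (fun w => A w i j) z.

Definition mxdzbar m n (A : R * R -> 'M[R[i]]_(m, n)) (z : R * R) :
    'M[R[i]]_(m, n) :=
  \matrix_(i, j) dzbar (fun w => A w i j) z.

Definition complexify m n (A : 'M[R]_(m, n)) : 'M[R[i]]_(m, n) :=
  map_mx (real_complex R) A.

Definition cexp (w : R[i]) : R[i] :=
  (expR (complex.Re w))%:C * (cos (complex.Im w) +i* sin (complex.Im w)).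

Definition log_branch (D : set (R * R)) (b logb : R * R -> R[i]) : Prop :=
  csmooth_on D logb /\ forall z, D z -> cexp (logb z) = b z.

End Calculus.

Section Surface.
Variable R : realType.

Definition RP3 := {l : {vspace 'cV[R]_4} | \dim l == 1%N}.

Definition lift_on (D : set (R * R)) (sf : R * R -> RP3)
    (f : R * R -> 'cV[R]_4) : Prop :=
  mxsmooth_on D f /\
  forall z, D z -> f z != 0 /\ val (sf z) = <[f z]>%VS.

(* The line spanned by f has injective differential iff df is injective modulo
   the radial direction. *)
Definition projectively_immersed_at (f : R * R -> 'cV[R]_4) (z : R * R) : Prop :=
  forall (v : R * R) (c : R), mxdir v f z = c *: f z -> v = 0.

Definition immersed_surface (D : set (R * R)) (sf : R * R -> RP3) : Prop :=
  forall z, D z -> exists (U : set (R * R)) (f : R * R -> 'cV[R]_4),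
    [/\ open U, U z, lift_on U sf f
      & forall w, U w -> projectively_immersed_at f w].

Definition vector_field_on (D : set (R * R)) (X : R * R -> R * R) : Prop :=
  smooth_on D (fun z => (X z).1) /\ smooth_on D (fun z => (X z).2).

Definition transversal (D : set (R * R)) (f xi : R * R -> 'cV[R]_4) : Prop :=
  mxsmooth_on D xi /\
  forall z, D z -> ~ exists (v : R * R) (c : R), xi z = mxdir v f z + c *: f z.

(* h is the form of the Gauss formula for the transversal field xi; the radial
   vector field along f is f itself. *)
Definition gauss_formula (D : set (R * R)) (f xi : R * R -> 'cV[R]_4)
    (h : R * R -> R * R -> R * R -> R) : Prop :=
  transversal D f xi /\
  exists (nabla : (R * R -> R * R) -> (R * R -> R * R) -> R * R -> R * R)
         (T : R * R -> R * R -> R * R -> R),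
    forall X Y, vector_field_on D X -> vector_field_on D Y ->
    forall z, D z ->
      mxdir (X z) (fun w => mxdir (Y w) f w) z =
        mxdir (nabla X Y z) f z + h z (X z) (Y z) *: xi z
        + T z (X z) (Y z) *: f z.

(* The coordinate x + iy is a complex coordinate of the conformal class of h. *)
Definition conformal_coordinate (D : set (R * R)) (f : R * R -> 'cV[R]_4) : Prop :=
  forall xi h, gauss_formula D f xi h ->
  forall z, D z ->
    h z (1, 0) (1, 0) = h z (0, 1) (0, 1) /\ h z (1, 0) (0, 1) = 0.

Definition positive_definite_projective_metric (D : set (R * R))
    (f : R * R -> 'cV[R]_4) (b : R * R -> R[i]) : Prop :=
  (exists xi h, gauss_formula D f xi h /\
     forall z, D z -> forall v : R * R, v != 0 -> 0 < h z v v) /\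
  forall z, D z -> b z != 0.

Definition canonical_system (D : set (R * R)) (f : R * R -> 'cV[R]_4)
    (b p : R * R -> R[i]) : Prop :=
  let fC := fun z => complexify (f z) in
  [/\ csmooth_on D b, csmooth_on D p
    & forall z, D z ->
        mxdz (mxdz fC) z = b z *: mxdzbar fC z + p z *: fC z /\
        mxdzbar (mxdzbar fC) z =
          (b z)^*%C *: mxdz fC z + (p z)^*%C *: fC z].

End Surface.

Section Invariants.
Variable R : realType.
Implicit Types b p logb : R * R -> R[i].

(* (log b)_{z zbar} does not depend on the branch logb. *)
Definition inv_k b logb (z : R * R) : R[i] :=
  (`|b z| ^+ 2 - dzbar (dz logb) z) / 2.

Definition inv_P b p (z : R * R) : R[i] :=
  let bb := fun w => (b w)^*%C in
  p z + dzbar b z / 2 - dz (dz bb) z / (2 * bb z)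
  + dz bb z ^+ 2 / (4 * bb z ^+ 2).

Definition demoulin (D : set (R * R)) b p : Prop :=
  forall z, D z -> inv_P b p z = 0.

Definition mx4 (K : nmodType) (s : seq (seq K)) : 'M[K]_4 :=
  \matrix_(i < 4, j < 4) nth 0 (nth [::] s i) j.

Definition matU b p logb (z : R * R) : 'M[R[i]]_4 :=
  let bb := fun w => (b w)^*%C in
  let a := dz bb z / (2 * bb z) in
  let k := inv_k b logb z in
  let P := inv_P b p z in
  mx4 [:: [:: a; P;   k; b z * P^*%C];
          [:: 1; - a; 0; k        ];
          [:: 0; b z; a; P        ];
          [:: 0; 0;   1; - a      ]].

Definition matV b p logb (z : R * R) : 'M[R[i]]_4 :=
  let c := dzbar b z / (2 * b z) in
  let k := inv_k b logb z in
  let P := inv_P b p z in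
  mx4 [:: [:: c; k^*%C; P^*%C;     (b z)^*%C * P];
          [:: 0; c;   (b z)^*%C; P^*%C    ];
          [:: 1; 0;   - c;     k^*%C      ];
          [:: 0; 1;   0;       - c        ]].

Definition normalized_frame (D : set (R * R)) b p logb (z0 : R * R)
    (F : R * R -> 'M[R[i]]_4) : Prop :=
  [/\ cmxsmooth_on D F, F z0 = 1%:M
    & forall z, D z ->
        mxdz F z = F z *m matU b p logb z /\
        mxdzbar F z = F z *m matV b p logb z].

End Invariants.

Section GaussMap.
Variable R : realType.

Definition matL : 'M[R[i]]_4 :=
  let s := (Num.sqrt (2 : R))%:C in
  s^-1 *: mx4 [:: [:: s; 0;  0;    0];
                  [:: 0; 'i%C; - 'i%C; 0];
                  [:: 0; 1;  1;    0];
                  [:: 0; 0;  0;    s]].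

Definition hatJ1 : 'M[R[i]]_4 :=
  mx4 [:: [:: 0; 0; 0; 1];
          [:: 0; 1; 0; 0];
          [:: 0; 0; 1; 0];
          [:: 1; 0; 0; 0]].

Definition sphere_space (Q : 'M[R]_4) : Prop :=
  [/\ Q^T = Q, \det Q = -1
    & exists l : 'I_4 -> R,
        [/\ char_poly Q = \prod_(i < 4) ('X - (l i)%:P),
            #|[set i | 0 < l i]%SET| = 3%N & #|[set i | l i < 0]%SET| = 1%N]].

Definition hatF (F : R * R -> 'M[R[i]]_4) (z : R * R) : 'M[R[i]]_4 :=
  matL *m F z *m invmx matL.

Definition gauss_map1 (F : R * R -> 'M[R[i]]_4) (z : R * R) : 'M[R[i]]_4 :=
  hatF F z *m hatJ1 *m (hatF F z)^T.

(* The invariant metric of the space of spheres at Q, extended complex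
   bilinearly to the complexified tangent space. *)
Definition sphere_metric (Q X Y : 'M[R[i]]_4) : R[i] :=
  \tr (invmx Q *m X *m invmx Q *m Y).

Definition conformal_map (D : set (R * R)) (g : R * R -> 'M[R[i]]_4) : Prop :=
  forall z, D z -> sphere_metric (g z) (mxdz g z) (mxdz g z) = 0.

End GaussMap.

(* Main.v *)
(**
With J1 the antidiagonal matrix and E = L F, the Gauss map is g = E J1 E^T and
E_z = E U, so g_z = E (U J1 + J1 U^T) E^T and the trace defining <g_z, g_z>
collapses to Tr ((J1 U J1 + U^T)^2) = 16 P; hence conformality is P = 0.

That g takes values in the space of spheres rests on two facts. Since U and V
are traceless, det F is locally constant, hence 1. Conjugation followed by
exchanging the two middle indices maps U to V, so it maps F to another
normalized solution of the same system; by uniqueness F is fixed, which says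
that L F L^-1 is real. The signature is then obtained from the spectral theorem:
det = -1 leaves one or three negative eigenvalues, and three would be
incompatible with the plane on which the form of J1-hat is positive definite.
*)
Require Import Defs.
From mathcomp Require Import all_boot all_order all_algebra.
From mathcomp Require Import all_classical all_reals all_analysis.
From mathcomp Require Import complex.
From mathcomp Require Import perm ring lra.
Import Order.TTheory GRing.Theory Num.Theory.
Import numFieldNormedType.Exports.
Local Open Scope classical_set_scope.
Local Open Scope ring_scope.
Local Open Scope complex_scope.

(** * Real functions with vanishing partial derivatives on a connected open set *)

Section LocallyConstant.
Set Implicit Arguments.
Unset Strict Implicit.
Variable R : realType.
Implicit Types (D : set (R * R)) (w : R * R -> R) (z v : R * R).

Lemma is_derive_line w z v (t : R) : derivable w (z + t *: v) v ->
  is_derive t 1 (fun s : R => w (z + s *: v)) ('D_v w (z + t *: v)).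
Proof.
move=> dw.
have E : (fun h : R => h^-1 *: (((fun s : R => w (z + s *: v)) \o shift t) (h *: 1) - w (z + t *: v)))
   = (fun h : R => h^-1 *: ((w \o shift (z + t *: v)) (h *: v) - w (z + t *: v))).
  by apply/funext => h /=; rewrite [h *: 1]mulr1 scalerDl addrCA.
by apply: DeriveDef; rewrite /derivable /derive E.
Qed.

Lemma segment_eq_of_derive0 w z v (t : R) :
  (forall s : R, `|s| <= `|t| -> is_derive (z + s *: v) v w 0) ->
  w (z + t *: v) = w z.
Proof.
move=> dw; pose c (s : R) := w (z + s *: v).
have dc (s : R) : `|s| <= `|t| -> is_derive s 1 c ((fun=> 0) s).
  move=> /dw dws; rewrite /= -(@derive_val _ _ _ _ _ _ _ dws).
  by apply: is_derive_line; exact: (@ex_derive _ _ _ _ _ _ _ dws).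
suff : c t = c 0 by rewrite /c scale0r addr0.
(* The mean value theorem takes ordered endpoints, hence one run on [[0, t]] and one on [[t, 0]]. *)
have [t0|t0] := leP 0 t.
  have bnd (s : R) : s \in `[0, t] -> `|s| <= `|t|.
    by rewrite in_itv /= => /andP[s0 st]; rewrite !ger0_norm.
  have [||s _] := @MVT_segment R c (fun=> 0) 0 t t0.
  - by move=> s st; apply: dc; apply: bnd; exact: subset_itv_oo_cc st.
  - apply: derivable_within_continuous => s /bnd /dc dcs.
    exact: (@ex_derive _ _ _ _ _ _ _ dcs).
  by rewrite mul0r => /subr0_eq.
have bnd (s : R) : s \in `[t, 0] -> `|s| <= `|t|.
  by rewrite in_itv /= => /andP[s0 st]; rewrite !ler0_norm ?lerN2// ltW.
have [||s _] := @MVT_segment R c (fun=> 0) t 0 (ltW t0).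
- by move=> s st; apply: dc; apply: bnd; exact: subset_itv_oo_cc st.
- apply: derivable_within_continuous => s /bnd /dc dcs.
  exact: (@ex_derive _ _ _ _ _ _ _ dcs).
by rewrite mul0r => /subr0_eq.
Qed.

(** Balls of the product are squares, so the path that goes horizontally from the centre and then
    vertically to the target stays inside; [w] is constant on both legs. *)
Lemma ball_eq_of_partials w z0 (r : R) :
  (forall z, ball z0 r z -> is_derive z (1, 0) w 0 /\ is_derive z (0, 1) w 0) ->
  forall z, ball z0 r z -> w z = w z0.
Proof.
move=> dw [x y] [/= bx by_].
have r0 : 0 < r by apply: le_lt_trans bx; exact: normr_ge0.
have b0 (a : R) : ball a r a by exact: ballxx.
have sub (a s t : R) : ball a r t -> `|s| <= `|t - a| -> ball a r (a + s).
  rewrite -!ball_normE /= opprD addNKr normrN distrC => h1 h2.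
  exact: le_lt_trans h2 h1.
have E1 : z0 + (x - z0.1) *: (1, 0) = (x, z0.2).
  by case: z0 {dw bx by_} => a b; congr pair; rewrite /= /GRing.scale /= ?mulr1 ?mulr0 ?addr0// addrC subrK.
have E2 : (x, z0.2) + (y - z0.2) *: (0, 1) = (x, y).
  by congr pair; rewrite /= /GRing.scale /= ?mulr1 ?mulr0 ?addr0// addrC subrK.
have S2 : w ((x, z0.2) + (y - z0.2) *: (0, 1)) = w (x, z0.2).
  apply: segment_eq_of_derive0 => s hs; apply: (dw _ _).2.
  split => /=; first by rewrite scaler0 addr0.
  by rewrite [s *: 1]mulr1; exact: sub by_ hs.
have S1 : w (z0 + (x - z0.1) *: (1, 0)) = w z0.
  apply: segment_eq_of_derive0 => s hs; apply: (dw _ _).1.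
  split => /=; first by rewrite [s *: 1]mulr1; exact: sub bx hs.
  by rewrite scaler0 addr0; exact: b0.
by rewrite -S1 E1 -S2 E2.
Qed.

(** The level set of [w] through [z0] is nonempty, open and closed relative to [D], hence all of
    [D]. *)
Lemma connected_eq_of_partials D w : open D -> connected D ->
  (forall z, D z -> is_derive z (1, 0) w 0 /\ is_derive z (0, 1) w 0) ->
  forall z0 z, D z0 -> D z -> w z = w z0.
Proof.
move=> oD cD dw z0 z Dz0 Dz.
have loc z1 : D z1 -> \forall z' \near z1, D z' /\ w z' = w z1.
  move=> Dz1; have /nbhs_ballP[r /= r0 br] := open_nbhs_nbhs (conj oD Dz1).
  apply/nbhs_ballP; exists r => //= z' bz'; split; first exact: br.
  by apply: ball_eq_of_partials bz' => x /br; exact: dw.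
(* By local constancy the preimage of any set of values is open. Taking [A] to be a single value,
   then its complement, gives openness and closedness of the level set. *)
have op (A : set R) : open (D `&` [set x | A (w x)]).
  rewrite openE => x [Dx Ax]; apply: filterS (loc _ Dx) => y [Dy wy].
  by split => //=; rewrite wy.
suff E : D `&` [set x | w x = w z0] = D by move: Dz; rewrite -{1}E => -[].
apply: cD; first by exists z0.
- exists (D `&` [set x | w x = w z0]); first exact: (op (eq^~ (w z0))).
  by rewrite setIA setIid.
- exists (~` (D `&` [set x | w x <> w z0])).
    exact/open_closedC/(op (fun y => y <> w z0)).
  apply/seteqP; split => x /= [Dx h]; split => //; first by case.
  by apply: contrapT => h'; apply: h.
Qed.

End LocallyConstant.

(** * Directional derivatives of complex and matrix-valued functions *)

Section ComplexDerivatives.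
Set Implicit Arguments.
Unset Strict Implicit.
Variables (R : realType) (z v : R * R).
Implicit Types (u w : R * R -> R[i]).

(** Unlike the bare value [cdir], this also records that the derivative exists, which the sum and
    product rules need. *)
Definition is_cderive u (du : R[i]) : Prop :=
  is_derive z v (fun x => complex.Re (u x)) (complex.Re du) /\
  is_derive z v (fun x => complex.Im (u x)) (complex.Im du).

Lemma cdir_val u du : is_cderive u du -> cdir v u z = du.
Proof. by case=> d1 d2; rewrite /cdir !derive_val; case: du {d1 d2}. Qed.

Lemma is_cderive_eq u du du' : is_cderive u du -> du = du' -> is_cderive u du'.
Proof. by move=> ? <-. Qed.

Lemma csmooth_is_cderive (D : set (R * R)) u :
  csmooth_on D u -> D z -> is_cderive u (cdir v u z).
Proof.
move=> [u1 u2] Dz; split; apply: derivableP; apply: diff_derivable.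
  exact: (u1 [::]).
exact: (u2 [::]).
Qed.

Lemma is_cderive_cst (c : R[i]) : is_cderive (fun=> c) 0.
Proof. by split; exact: is_derive_cst. Qed.

Lemma is_cderiveD u w du dw : is_cderive u du -> is_cderive w dw ->
  is_cderive (fun x => u x + w x) (du + dw).
Proof.
move=> [u1 u2] [w1 w2]; split; rewrite raddfD.
  under eq_fun do rewrite raddfD; exact: is_deriveD.
under eq_fun do rewrite raddfD; exact: is_deriveD.
Qed.

Lemma is_cderiveM u w du dw : is_cderive u du -> is_cderive w dw ->
  is_cderive (fun x => u x * w x) (du * w z + u z * dw).
Proof.
have ReM (a b : R[i]) : complex.Re (a * b) =
    complex.Re a * complex.Re b - complex.Im a * complex.Im b by case: a; case: b.
have ImM (a b : R[i]) : complex.Im (a * b) =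
    complex.Re a * complex.Im b + complex.Im a * complex.Re b by case: a; case: b.
move=> [u1 u2] [w1 w2]; split; rewrite raddfD /= ?(ReM, ImM).
  under eq_fun do rewrite ReM.
  apply: (is_derive_eq (is_deriveB (is_deriveM u1 w1) (is_deriveM u2 w2))).
  by rewrite /GRing.scale /=; ring.
under eq_fun do rewrite ImM.
apply: (is_derive_eq (is_deriveD (is_deriveM u1 w2) (is_deriveM u2 w1))).
by rewrite /GRing.scale /=; ring.
Qed.

Lemma is_cderive_conj u du : is_cderive u du -> is_cderive (fun x => (u x)^*) du^*.
Proof.
have ReJ (a : R[i]) : complex.Re a^* = complex.Re a by case: a.
have ImJ (a : R[i]) : complex.Im a^* = - complex.Im a by case: a.
move=> [u1 u2]; split; rewrite ?(ReJ, ImJ).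
  by under eq_fun do rewrite ReJ.
by under eq_fun do rewrite ImJ; exact: is_deriveN.
Qed.

Lemma is_cderive_sum (I : Type) (r : seq I) (P : pred I)
    (u : I -> R * R -> R[i]) (du : I -> R[i]) :
  (forall i, is_cderive (u i) (du i)) ->
  is_cderive (fun x => \sum_(i <- r | P i) u i x) (\sum_(i <- r | P i) du i).
Proof.
move=> udu; elim: r => [|i r IH].
  under eq_fun do rewrite big_nil; rewrite big_nil; exact: is_cderive_cst.
under eq_fun do rewrite big_cons; rewrite big_cons.
by case: (P i) => //; exact: is_cderiveD.
Qed.

Definition is_mxcderive m n (A : R * R -> 'M[R[i]]_(m, n)) (dA : 'M[R[i]]_(m, n)) :=
  forall i j, is_cderive (fun x => A x i j) (dA i j).

Lemma is_mxcderive_cst m n (A : 'M[R[i]]_(m, n)) : is_mxcderive (fun=> A) 0.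
Proof. by move=> i j; rewrite mxE; exact: is_cderive_cst. Qed.

Lemma is_mxcderiveM m n q (A : R * R -> 'M[R[i]]_(m, n)) (B : R * R -> 'M[R[i]]_(n, q))
    dA dB : is_mxcderive A dA -> is_mxcderive B dB ->
  is_mxcderive (fun x => A x *m B x) (dA *m B z + A z *m dB).
Proof.
move=> AdA BdB i j; rewrite !mxE -big_split /=.
under eq_fun do rewrite mxE.
by apply: is_cderive_sum => k; exact: is_cderiveM.
Qed.

Lemma is_mxcderive_tr m n (A : R * R -> 'M[R[i]]_(m, n)) dA :
  is_mxcderive A dA -> is_mxcderive (fun x => (A x)^T) dA^T.
Proof. by move=> AdA i j; rewrite !mxE; under eq_fun do rewrite mxE; exact: AdA. Qed.

(* First-order jets: [U] records the value and the derivative of [u] modulo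
   ['X^2], so that a polynomial expression is differentiated by evaluating it
   on polynomials. *)
Definition jet u (U : {poly R[i]}) : Prop := u z = U`_0 /\ is_cderive u U`_1.

Lemma jet_cst (c : R[i]) : jet (fun=> c) c%:P.
Proof. by split; rewrite coefC //=; exact: is_cderive_cst. Qed.

Lemma jetD u w U W : jet u U -> jet w W -> jet (fun x => u x + w x) (U + W).
Proof.
by move=> [u0 u1] [w0 w1]; split; rewrite coefD ?u0 ?w0//; exact: is_cderiveD.
Qed.

Lemma jetM u w U W : jet u U -> jet w W -> jet (fun x => u x * w x) (U * W).
Proof.
move=> [u0 u1] [w0 w1]; split; first by rewrite coefM big_ord1 u0 w0.
apply: (is_cderive_eq (is_cderiveM u1 w1)).
by rewrite coefM !big_ord_recl big_ord0 addr0 u0 w0 addrC.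
Qed.

(** The Leibniz formula is a polynomial expression in the entries, so jets propagate through it term
    by term. *)
Lemma jet_det n (A : R * R -> 'M[R[i]]_n) (U : 'M[{poly R[i]}]_n) :
  (forall i j, jet (fun x => A x i j) (U i j)) -> jet (fun x => \det (A x)) (\det U).
Proof.
move=> AU; have jet_prod (s : 'S_n) (r : seq 'I_n) :
    jet (fun x => \prod_(i <- r) A x i (s i)) (\prod_(i <- r) U i (s i)).
  elim: r => [|i r IH].
    by under eq_fun do rewrite big_nil; rewrite big_nil; exact: jet_cst.
  by under eq_fun do rewrite big_cons; rewrite big_cons; exact: jetM.
rewrite /determinant; elim: (index_enum _) => [|s r IH].
  by under eq_fun do rewrite big_nil; rewrite big_nil; exact: (jet_cst 0).
under eq_fun do rewrite big_cons; rewrite big_cons; apply: jetD IH.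
apply: jetM; last exact: jet_prod.
have -> : (-1) ^+ s = ((-1) ^+ s)%:P :> {poly R[i]} by rewrite rmorphXn rmorphN1.
exact: jet_cst.
Qed.

End ComplexDerivatives.

(** * Linear differential systems: evolution of the determinant and uniqueness *)

Lemma coef1_prod_1DX (K : comNzRingType) (I : Type) (r : seq I) (a : I -> K) :
  (\prod_(i <- r) (1 + (a i)%:P * 'X))`_0 = 1 /\
  (\prod_(i <- r) (1 + (a i)%:P * 'X))`_1 = \sum_(i <- r) a i.
Proof.
elim: r => [|i r [IH0 IH1]]; first by rewrite !big_nil !coef1.
rewrite !big_cons mulrDl mul1r mulrAC !coefD !coefMX IH0 IH1 /=.
by rewrite coefCM IH0 mulr1 addr0 addrC.
Qed.

(** To first order only the identity permutation counts: any other [s] moves some [i] and then also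
    [s i], so its term contains two off-diagonal factors and is divisible by ['X^2]. *)
Lemma coef1_det_1DX (K : comNzRingType) n (W : 'M[K]_n) :
  (\det (1%:M + map_mx (fun a => a%:P * 'X) W))`_1 = \tr W.
Proof.
rewrite /determinant (bigD1 (1%g : {perm 'I_n})) //= coefD odd_perm1 expr0 mul1r.
under eq_bigr do rewrite !mxE perm1 eqxx.
rewrite (coef1_prod_1DX _ (fun i => W i i)).2 [X in _ + X](_ : _ = 0) ?addr0//.
rewrite coef_sum big1 // => s s1.
have [i si] : exists i, s i != i.
  apply/existsP; apply: contraR s1; rewrite negb_exists => /forallP sid.
  by apply/eqP/permP => i; rewrite perm1; apply/eqP; have := sid i; rewrite negbK.
have sj : s (s i) != s i by rewrite (inj_eq perm_inj).
have off j : s j != j -> (1%:M + map_mx (fun a : K => a%:P * 'X) W) j (s j) =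
    (W j (s j))%:P * 'X.
  by move=> sj'; rewrite mxE [1%:M _ _]mxE [map_mx _ _ _ _]mxE eq_sym (negPf sj') add0r.
rewrite (bigD1 i isT) [X in _ * (_ * X)](bigD1 (s i)) ?sj // (off i si) (off (s i)) ?(inj_eq perm_inj) //.
set q := \prod_(_ < _ | _) _.
set t := (X in (X * _)%R); set M := (X in _ * X).
have -> : t * M = t * (W i (s i))%:P * (W (s i) (s (s i)))%:P * q * 'X * 'X.
  by rewrite /M /=; ring.
by rewrite coefMX /= coefMX.
Qed.

Section LinearSystem.
Set Implicit Arguments.
Unset Strict Implicit.
Variable R : realType.

(** Liouville's formula. The jet of [A] at [z] factors as [A z] times [1 + 'X W], and the
    determinant is multiplicative. *)
Lemma is_cderive_det (z v : R * R) n (A : R * R -> 'M[R[i]]_n) (W : 'M[R[i]]_n) :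
  is_mxcderive z v A (A z *m W) ->
  is_cderive z v (fun x => \det (A x)) (\det (A z) * \tr W).
Proof.
move=> AW.
pose U := map_mx polyC (A z) *m (1%:M + map_mx (fun a => a%:P * 'X) W).
have /jet_det : forall i j, jet z v (fun x => A x i j) (U i j).
  move=> i j; rewrite /U mulmxDr mulmx1 mxE [map_mx _ _ _ _]mxE.
  have -> : (map_mx polyC (A z) *m map_mx (fun a => a%:P * 'X) W) i j =
      ((A z *m W) i j)%:P * 'X.
    rewrite !mxE rmorph_sum mulr_suml; apply: eq_bigr => k _.
    by rewrite !mxE mulrA rmorphM.
  by split; rewrite coefD coefMX !coefC /= ?addr0 ?add0r.
case=> _; rewrite /U det_mulmx det_map_mx /= coefCM.
by rewrite coef1_det_1DX.
Qed.

Lemma connected_eq_of_cderive0 (D : set (R * R)) (u : R * R -> R[i]) :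
  open D -> connected D ->
  (forall z, D z -> is_cderive z (1, 0) u 0 /\ is_cderive z (0, 1) u 0) ->
  forall z0 z, D z0 -> D z -> u z = u z0.
Proof.
move=> oD cD du z0 z Dz0 Dz.
have uRe : complex.Re (u z) = complex.Re (u z0).
  apply: (connected_eq_of_partials oD cD (w := fun x => complex.Re (u x))) => //.
  by move=> x /du[[? _] [? _]].
have uIm : complex.Im (u z) = complex.Im (u z0).
  apply: (connected_eq_of_partials oD cD (w := fun x => complex.Im (u x))) => //.
  by move=> x /du[[_ ?] [_ ?]].
by move: uRe uIm; case: (u z) => a c; case: (u z0) => a' c' /= -> ->.
Qed.

Variables (D : set (R * R)) (n : nat) (W1 W2 : R * R -> 'M[R[i]]_n).
Hypotheses (oD : open D) (cD : connected D).
Hypotheses (W1tr : forall z, D z -> \tr (W1 z) = 0)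
           (W2tr : forall z, D z -> \tr (W2 z) = 0).

(** The system is stated along the two real axes rather than in [dz] and [dzbar], since constancy on
    [D] is tested on real partial derivatives. *)
Definition frame_on (A : R * R -> 'M[R[i]]_n) : Prop :=
  forall z, D z -> is_mxcderive z (1, 0) A (A z *m W1 z) /\
                   is_mxcderive z (0, 1) A (A z *m W2 z).

Lemma frame_det A : frame_on A ->
  forall z0 z, D z0 -> D z -> \det (A z) = \det (A z0).
Proof.
move=> AD; apply: connected_eq_of_cderive0 => // z Dz; have [A1 A2] := AD z Dz.
split.
  by apply: is_cderive_eq (is_cderive_det A1) _; rewrite W1tr// mulr0.
by apply: is_cderive_eq (is_cderive_det A2) _; rewrite W2tr// mulr0.
Qed.

(* Replacing row [i] of [A] by row [j] of [B] yields another solution, whose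
   determinant is the entry [(j, i)] of [B *m \adj A]; it is constant, hence so
   is [B *m \adj A]. *)
Lemma frame_unique A B z0 : D z0 -> A z0 = 1%:M -> B z0 = 1%:M ->
  frame_on A -> frame_on B -> forall z, D z -> A z = B z.
Proof.
move=> Dz0 A0 B0 AD BD z Dz.
pose M i j x := \matrix_(k, l) if k == i then B x j l else A x k l.
have MD i j : frame_on (M i j).
  move=> x Dx; have [A1 A2] := AD x Dx; have [B1 B2] := BD x Dx.
  (* Right multiplication acts on each row separately, so rows taken from two solutions may be
     mixed. *)
  have MW (W : 'M[R[i]]_n) k l : (M i j x *m W) k l =
      if k == i then (B x *m W) j l else (A x *m W) k l.
    by rewrite !mxE; case: ifP => ki; apply: eq_bigr => m _; rewrite !mxE ki.
  by split=> k l; rewrite MW /M; under eq_fun do rewrite mxE; case: ifP => _.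
have detM i j x : \det (M i j x) = (B x *m \adj (A x)) j i.
  (* Cofactors along row [i] do not see that row, so they are those of [A]. *)
  rewrite (expand_det_row _ i) mxE; apply: eq_bigr => l _.
  rewrite !mxE eqxx /cofactor; congr (_ * (_ * \det _)).
  by apply/matrixP => k m; rewrite !mxE eq_sym (negPf (neq_lift _ _)).
have detA : \det (A z) = 1 by rewrite (frame_det AD Dz0 Dz) A0 det1.
have E : B z *m \adj (A z) = 1%:M.
  apply/matrixP => j i; rewrite -detM (frame_det (MD i j) Dz0 Dz) detM A0 B0.
  by rewrite mul1mx adj1.
have adjA : \adj (A z) *m A z = 1%:M by rewrite mul_adj_mx detA.
by rewrite -[RHS]mulmx1 -adjA mulmxA E mul1mx.
Qed.

End LinearSystem.

(** * Signature of a real matrix congruent to [hatJ1] *)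

Section Signature.
Set Implicit Arguments.
Unset Strict Implicit.
Variable R : realType.
Local Open Scope sesquilinear_scope.

Lemma char_poly_conj (K : comUnitRingType) n (P A : 'M[K]_n) :
  P \in unitmx -> char_poly (invmx P *m A *m P) = char_poly A.
Proof.
move=> Pu; have VP : map_mx polyC (invmx P) *m map_mx polyC P = 1%:M.
  by rewrite -map_mxM mulVmx// map_mx1.
rewrite /char_poly.
have -> : char_poly_mx (invmx P *m A *m P) =
    map_mx polyC (invmx P) *m char_poly_mx A *m map_mx polyC P.
  by rewrite /char_poly_mx !map_mxM mulmxBr mulmxBl scalar_mxC -(mulmxA 'X%:M) VP mulmx1.
by rewrite !det_mulmx mulrAC -det_mulmx VP det1 mul1r.
Qed.

(** A real symmetric matrix is Hermitian over [R[i]], so the spectral theorem applies and its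
    eigenvalues are real; taking their real parts loses nothing. *)
Lemma realsym_spectral n (Q : 'M[R]_n) : Q^T = Q ->
  exists (l : 'I_n -> R) (P : 'M[R[i]]_n), P \is unitarymx /\
    complexify Q = invmx P *m diag_mx (\row_i (l i)%:C) *m P.
Proof.
move=> Qsym.
have Qherm : complexify Q \is hermsymmx.
  apply: realsym_hermsym.
    apply/is_hermitianmxP; rewrite expr0 scale1r map_mx_id//.
    by rewrite /complexify map_trmx Qsym.
  by apply/mxOverP => i j; rewrite mxE; apply/complex_realP; exists (Q i j).
exists (fun i => complex.Re (spectral_diag (complexify Q) 0 i)), (spectralmx (complexify Q)).
split; first exact: spectral_unitarymx.
have -> : \row_i (complex.Re (spectral_diag (complexify Q) 0 i))%:C =
    spectral_diag (complexify Q).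
  apply/rowP => i; rewrite mxE RRe_real//.
  exact: (mxOverP (hermitian_spectral_diag_real Qherm)).
exact/orthomx_spectralP/hermitian_normalmx.
Qed.

(** The form of [hatJ1] is positive definite on the plane of rows [(0, a, b, 0)]. One linear
    condition leaves a nonzero such row whose [i0] coordinate in the diagonalizing basis vanishes;
    were all other weights nonpositive, the form would be nonpositive there. *)
Lemma hatJ1_not_nonpos_off (B : 'M[R[i]]_4) (l : 'rV[R[i]]_4) (i0 : 'I_4) :
  hatJ1 R = B *m diag_mx l *m B^t* ->
  exists2 i, i != i0 & ~~ (l 0 i <= 0).
Proof.
move=> JE; apply/exists_inP; apply: contraT; rewrite negb_exists_in => /forall_inP lneg.
have [y y00 yB] : exists2 y : 'rV[R[i]]_4, 0 < (y *m hatJ1 R *m y^t*) 0 0 &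
    (y *m B) 0 i0 = 0.
  pose c1 := B (lift ord0 ord0) i0; pose c2 := B (lift ord0 (lift ord0 ord0)) i0.
  have [a [b [ab0 abc]]] : exists a b : R[i], 0 < a * a^*%R + b * b^*%R /\ a * c1 + b * c2 = 0.
    (* The pair [(- c2, c1)] always solves the equation and is visibly nonzero when [c1] is;
       otherwise [(1, 0)] does. *)
    have [c10|c10] := eqVneq c1 0.
      exists 1, 0; split; last by rewrite c10 mulr0 mul0r addr0.
      by rewrite mul0r addr0 rmorph1 mulr1.
    exists (- c2), c1; split; last by ring.
    rewrite -!normCK; apply: ltr_wpDl; first exact: exprn_ge0.
    by rewrite exprn_gt0// normr_gt0.
  exists (\row_j nth 0 [:: 0; a; b; 0] j).
    suff -> : (\row_j nth 0 [:: 0; a; b; 0] j *m hatJ1 R *m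
        (\row_j nth 0 [:: 0; a; b; 0] j)^t*) 0 0 = a * a^*%R + b * b^*%R by [].
    rewrite !mxE !big_ord_recl big_ord0 !mxE !big_ord_recl !big_ord0 !mxE /=.
    by rewrite !(mulr0, mul0r, addr0, add0r, mulr1).
  by rewrite mxE !big_ord_recl big_ord0 !mxE /= !mul0r !addr0 add0r.
suff : (y *m hatJ1 R *m y^t*) 0 0 <= 0 by move=> /(lt_le_trans y00); rewrite ltxx.
have -> : y *m hatJ1 R *m y^t* = (y *m B) *m diag_mx l *m (y *m B)^t*.
  by rewrite JE trmx_mul map_mxM !mulmxA.
move: (y *m B) yB => x yB.
rewrite mul_mx_diag mxE; apply: sumr_le0 => i _; rewrite !mxE.
have [->|ii0] := eqVneq i i0; first by rewrite yB !mul0r.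
rewrite mulrAC -normCK; apply: mulr_ge0_le0; first exact: exprn_ge0.
by have := lneg i ii0; rewrite negbK.
Qed.

Lemma sphere_space_congr (Q : 'M[R]_4) (N : 'M[R[i]]_4) :
  complexify Q = N *m hatJ1 R *m N^T -> map_mx Num.conj N = N -> \det N = 1 ->
  sphere_space Q.
Proof.
move=> QN Nreal N1.
have detJ : \det (hatJ1 R) = -1.
  have -> : hatJ1 R = perm_mx (tperm ord0 ord_max).
    apply/matrixP => i j; rewrite !mxE permE /=.
    by case: i => [[|[|[|[|]]]]] //; case: j => [[|[|[|[|]]]]].
  by rewrite det_perm odd_tperm.
have Qsym : Q^T = Q.
  have Jsym : (hatJ1 R)^T = hatJ1 R.
    by apply/matrixP => i j; rewrite !mxE; case: i => [[|[|[|[|]]]]] //; case: j => [[|[|[|[|]]]]].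
  have : (complexify Q)^T = complexify Q.
    by rewrite QN !trmx_mul trmxK Jsym mulmxA.
  by move=> /matrixP QT; apply/matrixP => i j; have := QT i j; rewrite !mxE => -[].
have detQ : \det Q = -1.
  apply: complexI; rewrite -det_map_mx -/(complexify Q) QN !det_mulmx det_tr N1 detJ.
  by rewrite mul1r mulr1 rmorphN1.
have [l [P [Pu QP]]] := realsym_spectral Qsym.
have Punit := unitarymx_unit Pu.
have cQ : char_poly Q = \prod_(i < 4) ('X - (l i)%:P).
  apply: (map_poly_inj (real_complex R)).
  rewrite map_char_poly -/(complexify Q) QP char_poly_conj// char_poly_trig ?diag_mx_is_trig//.
  rewrite rmorph_prod; apply: eq_bigr => i _.
  by rewrite /= map_polyXsubC !mxE eqxx.
have lprod : \prod_(i < 4) l i = -1.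
  apply: complexI; rewrite rmorph_prod -detQ -det_map_mx -/(complexify Q) QP.
  rewrite !det_mulmx mulrAC -det_mulmx mulVmx// det1 mul1r det_diag.
  by apply: eq_bigr => i _; rewrite mxE.
have lpos (i0 : 'I_4) : exists2 i, i != i0 & 0 < l i.
  have [|i ii0] := @hatJ1_not_nonpos_off (invmx (P *m N)) (\row_i (l i)%:C) i0.
    have Ku : P *m N \in unitmx by rewrite unitmx_mul Punit unitmxE N1 unitr1.
    (* Since [N] is real its adjoint is its transpose, and since [P] is unitary its adjoint is its
       inverse: the real congruence becomes a Hermitian one. *)
    have -> : diag_mx (\row_i (l i)%:C) = (P *m N) *m hatJ1 R *m (P *m N)^t*.
      rewrite trmx_mul map_mxM -(invmx_unitary Pu) -map_trmx Nreal.
      rewrite -!mulmxA (mulmxA N) (mulmxA (N *m _)) -QN QP !mulmxA.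
      by rewrite mulmxV// mul1mx mulmxK.
    move: (P *m N) Ku => K Ku.
    rewrite !mulmxA mulVmx// mul1mx -mulmxA -map_mxM -trmx_mul mulVmx//.
    by rewrite trmx1 map_mx1 mulmx1.
  by rewrite mxE lecR -ltNge => li; exists i.
pose A := [set i | 0 < l i]%SET; pose B := [set i | l i < 0]%SET.
have l0 i : l i != 0.
  apply/eqP => li; have /eqP := lprod.
  by rewrite (bigD1 i)//= li mul0r eq_sym oppr_eq0 oner_eq0.
have BA : B = ~: A.
  by apply/setP => i; rewrite !inE -leNgt le_eqVlt (negPf (l0 i)).
(* Excluding an index already found yields a second positive one. *)
have A2 : (1 < #|A|)%N.
  have [i _ li] := lpos ord0; have [j ji lj] := lpos i.
  by apply/card_gt1P; exists j, i; rewrite !inE.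
have AB : (#|A| + #|B| = 4)%N by rewrite BA cardsC card_ord.
(* The sign of the product of the eigenvalues gives the parity of the number of negative ones; being
   odd and below 3, this number is 1. *)
have Bodd : (-1) ^+ #|B| = -1 :> R.
  have S : Num.sg (\prod_(i < 4) l i) = -1 by rewrite lprod sgrN sgr1.
  rewrite -[RHS]S.
  rewrite (big_morph _ (@sgrM R) (@sgr1 R)) (bigID (mem B)) /= -prodr_const.
  rewrite [X in _ * X]big1 ?mulr1 => [|i].
    by apply: eq_bigr => i; rewrite inE => li; rewrite ltr0_sg.
  by rewrite BA !inE negbK => li; rewrite gtr0_sg.
have B1 : #|B| = 1%N.
  have B3 : (#|B| < 3)%N 
    by rewrite ltnNge; apply/negP => B3; have := leq_add A2 B3; rewrite AB.
  move: Bodd B3; case: #|B| => [|[|[|n]]] // /eqP.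
    by rewrite expr0 eq_sym -subr_eq0 -opprD oppr_eq0 -(natrD _ 1 1) pnatr_eq0.
  by rewrite sqrrN expr1n eq_sym -subr_eq0 -opprD oppr_eq0 -(natrD _ 1 1) pnatr_eq0.
by split => //; exists l; split => //; move: AB; rewrite B1 addn1 => -[].
Qed.

End Signature.

(** * The constant matrices and the trace computation *)

Section GaussMapFrame.
Set Implicit Arguments.
Unset Strict Implicit.
Variable R : realType.
Implicit Types (D : set (R * R)) (b p logb : R * R -> R[i]) (z v : R * R).
Implicit Types (F : R * R -> 'M[R[i]]_4).

Definition antidiag : 'M[R[i]]_4 :=
  mx4 [:: [:: 0; 0; 0; 1]; [:: 0; 0; 1; 0]; [:: 0; 1; 0; 0]; [:: 1; 0; 0; 0]].

(** Indices count from 0: these are the places of [f_1] and [f_2] in the Wilczynski frame, which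
    complex conjugation exchanges. *)
Definition swap12 : {perm 'I_4} := tperm (lift ord0 ord0) (lift ord0 (lift ord0 ord0)).

Lemma matL_antidiag : hatJ1 R = matL R *m antidiag *m (matL R)^T.
Proof.
have ss : (Num.sqrt (2 : R))%:C * (Num.sqrt (2 : R))%:C = 2.
  by rewrite -rmorphM -expr2 sqr_sqrtr ?ler0n// rmorph_nat.
have s0 : (Num.sqrt (2 : R))%:C != 0.
  by apply/eqP => s0; have := ss; rewrite s0 mul0r => /eqP; rewrite eq_sym pnatr_eq0.
rewrite /matL; move: ((Num.sqrt (2 : R))%:C) ss s0 => s ss s0.
have ii : 'i%C * 'i%C = -1 :> R[i] by rewrite -expr2 sqr_i.
rewrite linearZ /= -scalemxAl -scalemxAr -scalemxAl scalerA.
have -> : s^-1 * s^-1 = 2^-1 by rewrite -invfM ss.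
apply/matrixP => i j; rewrite !mxE !big_ord_recl !big_ord0 !mxE !big_ord_recl !big_ord0 !mxE /=.
case: i => [[|[|[|[|]]]]] //; case: j => [[|[|[|[|]]]]] // ? ? /=;
  rewrite !(mulr0, mul0r, addr0, add0r, mulr1, mul1r, mulrN, mulNr) ?ss ?ii ?opprK ?mulVf ?pnatr_eq0 //; ring: ii.
Qed.

Lemma antidiag_mul : antidiag *m antidiag = 1%:M.
Proof.
apply/matrixP => i j; rewrite !mxE !big_ord_recl big_ord0 !mxE /=.
by case: i => [[|[|[|[|]]]]] //; case: j => [[|[|[|[|]]]]] // ? ? /=;
  rewrite !(mulr0, mul0r, addr0, add0r, mulr1).
Qed.

Lemma hatJ1_mul : hatJ1 R *m hatJ1 R = 1%:M.
Proof.
apply/matrixP => i j; rewrite !mxE !big_ord_recl big_ord0 !mxE /=.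
by case: i => [[|[|[|[|]]]]] //; case: j => [[|[|[|[|]]]]] // ? ? /=;
  rewrite !(mulr0, mul0r, addr0, add0r, mulr1).
Qed.

Lemma matL_unit : matL R \in unitmx.
Proof.
have : matL R *m (antidiag *m (matL R)^T *m hatJ1 R) = 1%:M.
  by rewrite !mulmxA -matL_antidiag hatJ1_mul.
by case/mulmx1_unit.
Qed.

Lemma swap12V : (swap12^-1)%g = swap12. Proof. exact: tpermV. Qed.

Lemma swap12_mul : perm_mx swap12 *m perm_mx swap12 = 1%:M :> 'M[R[i]]_4.
Proof. by rewrite -perm_mxM tperm2 perm_mx1. Qed.

(** The only nonreal entries, ['i] and [- 'i], sit side by side in the second row, and the two
    middle columns agree elsewhere. *)
Lemma matL_conj : map_mx conjc (matL R) = matL R *m perm_mx swap12.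
Proof.
rewrite -swap12V -col_permE /matL.
have sV : ((Num.sqrt (2 : R))%:C^-1)^*%C = (Num.sqrt (2 : R))%:C^-1.
  by rewrite conjc_inv conjc_real.
apply/matrixP => i j; rewrite !mxE rmorphM !permE; congr (_ * _); first exact: sV.
by case: i => [[|[|[|[|]]]]] //; case: j => [[|[|[|[|]]]]] // ? ? /=;
  apply/eqP; rewrite eq_complex /= ?opprK ?oppr0 ?eqxx.
Qed.

Lemma gauss_map1E F z : gauss_map1 F z =
  (matL R *m F z) *m antidiag *m (matL R *m F z)^T.
Proof.
have LV : (matL R)^T *m (invmx (matL R))^T = 1%:M.
  by rewrite -trmx_mul (mulVmx matL_unit) trmx1.
rewrite /gauss_map1 /hatF matL_antidiag !trmx_mul !mulmxA (mulmxKV matL_unit).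
by rewrite -(mulmxA _ (matL R)^T (invmx (matL R))^T) LV mulmx1.
Qed.

(** The pattern of [matU] with independent entries, [c] standing for [b] and [Q] for the conjugate
    of [P]; the trace then becomes a polynomial identity. *)
Definition frame_entries (a k P c Q : R[i]) : 'M[R[i]]_4 :=
  mx4 [:: [:: a; P;   k; c * Q]; [:: 1; - a; 0; k];
          [:: 0; c; a; P];        [:: 0; 0;   1; - a]].

Lemma tr_frame_entries (a k P c Q : R[i]) (U := frame_entries a k P c Q)
    (M := U *m antidiag + antidiag *m U^T) :
  \tr (antidiag *m M *m antidiag *m M) = 16 * P.
Proof.
(* This is [antidiag *m U *m antidiag + U^T]; each diagonal entry of its square equals [4 * P]. *)
pose M' := mx4 [:: [:: 0; 2; 0; 0]; [:: 2 * P; 0; 2 * c; 0];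
                  [:: 2 * k; 0; 0; 2]; [:: 2 * (c * Q); 2 * k; 2 * P; 0]] : 'M[R[i]]_4.
have JM : antidiag *m M = M'.
  rewrite /M mulmxDr !mulmxA antidiag_mul mul1mx /M'.
  apply/matrixP => i j; rewrite !mxE !big_ord_recl !big_ord0 !mxE !big_ord_recl !big_ord0 !mxE /=.
  by case: i => [[|[|[|[|]]]]] //; case: j => [[|[|[|[|]]]]] // ? ? /=;
    rewrite !(mulr0, mul0r, addr0, add0r, mulr1, mul1r); ring.
rewrite -mulmxA JM /mxtrace !big_ord_recl big_ord0 !mxE !big_ord_recl !big_ord0 !mxE /=.
by ring.
Qed.

Lemma matUE b p logb z : exists a k c Q,
  matU b p logb z = frame_entries a k (inv_P b p z) c Q.
Proof. by do 4 eexists; rewrite /matU /frame_entries. Qed.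

Lemma mxtrace_matU b p logb z : \tr (matU b p logb z) = 0.
Proof. rewrite /mxtrace !big_ord_recl big_ord0 !mxE /=; ring. Qed.

Lemma mxtrace_matV b p logb z : \tr (matV b p logb z) = 0.
Proof. rewrite /mxtrace !big_ord_recl big_ord0 !mxE /=; ring. Qed.

(** * Conjugation symmetry of the system and reality of the frame *)

Lemma cdir_dz (u : R * R -> R[i]) z :
  cdir (1, 0) u z = dz u z + dzbar u z /\
  cdir (0, 1) u z = 'i%C * (dz u z - dzbar u z).
Proof.
have ii : 'i%C * 'i%C = -1 :> R[i] by rewrite -expr2 sqr_i.
rewrite /dz /dzbar; move: (cdir _ _ _) (cdir _ _ _) => x y; split; first by field.
by field: ii.
Qed.

Lemma conjcM (x y : R[i]) : (x * y)^*%C = x^*%C * y^*%C.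
Proof. exact: rmorphM. Qed.

Lemma conj_dzbar D b z : csmooth_on D b -> D z ->
  dz (fun w => (b w)^*%C) z = (dzbar b z)^*%C.
Proof.
move=> bD Dz; rewrite /dz /dzbar.
have cJ v : cdir v (fun w => (b w)^*%C) z = (cdir v b z)^*%C.
  exact: cdir_val (is_cderive_conj (csmooth_is_cderive v bD Dz)).
rewrite !cJ; move: (cdir _ _ _) (cdir _ _ _) => x y.
have c2 : (2^-1 : R[i])^*%C = 2^-1 by rewrite conjc_inv conjc_nat.
rewrite [in RHS]rmorphM; congr (_ * _); last exact/esym/c2.
by case: x => x1 x2; case: y => y1 y2; apply/eqP; rewrite eq_complex /=;
  apply/andP; split; apply/eqP; ring.
Qed.

Lemma swap12_matV D b p logb z : csmooth_on D b -> D z ->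
  perm_mx swap12 *m map_mx conjc (matV b p logb z) *m perm_mx swap12^-1 =
  matU b p logb z.
Proof.
move=> bD Dz; rewrite -row_permE -col_permE.
(* This matches the diagonals of the two matrices; the other entries correspond by inspection. *)
have a_conj : (dzbar b z / (2 * b z))^*%C =
    dz (fun w => (b w)^*%C) z / (2 * (b z)^*%C).
  by rewrite (conj_dzbar bD Dz) (conjcM (dzbar b z)) conjc_inv (conjcM 2) conjc_nat.
rewrite /matV /matU; cbv beta zeta; rewrite -a_conj.
move: (dzbar b z / (2 * b z)).
move: (inv_k b logb z) (inv_P b p z) (b z) => k P b' c.
have cN (x : R[i]) : (- x)^*%C = - x^*%C by exact: rmorphN.
apply/matrixP => i j; rewrite !mxE !permE.
by case: i => [[|[|[|[|]]]]] //; case: j => [[|[|[|[|]]]]] // ? ?;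
  rewrite [LHS]/= [RHS]/= ?conjcM ?cN ?conjcK //;
  apply/eqP; rewrite eq_complex /= oppr0 !eqxx.
Qed.

Lemma swap12_matU D b p logb z : csmooth_on D b -> D z ->
  perm_mx swap12 *m map_mx conjc (matU b p logb z) *m perm_mx swap12^-1 =
  matV b p logb z.
Proof.
move=> bD Dz; rewrite -(swap12_matV p logb bD Dz) !map_mxM !map_perm_mx swap12V.
rewrite -map_mx_comp map_mx_id => [|x]; last exact: conjcK.
by rewrite !mulmxA swap12_mul mul1mx -mulmxA swap12_mul mulmx1.
Qed.

(** Conjugating [hatF F z *m matL R = matL R *m F z] puts [perm_mx swap12] next to [matL R] on both
    sides, and the assumed symmetry of [F z] absorbs it. *)
Lemma conj_hatF F z :
  perm_mx swap12 *m map_mx conjc (F z) *m perm_mx swap12^-1 = F z ->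
  map_mx conjc (hatF F z) = hatF F z.
Proof.
move=> FJ.
have hL : hatF F z *m matL R = matL R *m F z by rewrite /hatF mulmxKV ?matL_unit.
have : map_mx conjc (hatF F z) *m matL R = matL R *m F z.
  rewrite -[in RHS]FJ swap12V !mulmxA -matL_conj -map_mxM -hL map_mxM matL_conj.
  by rewrite -!mulmxA swap12_mul mulmx1.
by rewrite -hL => /(congr1 (mulmx^~ (invmx (matL R)))); rewrite !(mulmxK matL_unit).
Qed.

Lemma normalized_frame_on D b p logb z0 F :
  normalized_frame D b p logb z0 F -> forall z, D z ->
  is_mxcderive z (1, 0) F (F z *m (matU b p logb z + matV b p logb z)) /\
  is_mxcderive z (0, 1) F (F z *m ('i%C *: (matU b p logb z - matV b p logb z))).
Proof.
move=> [Fs _ FUV] z Dz; have [FU FV] := FUV z Dz.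
have Fe i j v : is_cderive z v (fun x => F x i j) (cdir v (fun x => F x i j) z).
  exact: csmooth_is_cderive (Fs i j) Dz.
split=> i j; apply: is_cderive_eq (Fe i j _) _.
  by rewrite (cdir_dz _ _).1 mulmxDr -FU -FV !mxE.
by rewrite (cdir_dz _ _).2 -scalemxAr mulmxBr -FU -FV !mxE.
Qed.

Lemma frame_real D b p logb z0 F : open D -> connected D -> csmooth_on D b -> D z0 ->
  normalized_frame D b p logb z0 F -> forall z, D z ->
  \det (F z) = 1 /\ perm_mx swap12 *m map_mx conjc (F z) *m perm_mx swap12^-1 = F z.
Proof.
move=> oD cD bD Dz0 F_frame; have [_ F0 _] := F_frame.
pose U := matU b p logb; pose V := matV b p logb.
pose W1 z := U z + V z; pose W2 z := 'i%C *: (U z - V z).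
have W1tr z : D z -> \tr (W1 z) = 0.
  by move=> _; rewrite /W1 mxtraceD mxtrace_matU mxtrace_matV addr0.
have W2tr z : D z -> \tr (W2 z) = 0.
  by move=> _; rewrite /W2 mxtraceZ raddfB /= mxtrace_matU mxtrace_matV subr0 mulr0.
have FD : frame_on D W1 W2 F by move=> z Dz; exact: normalized_frame_on F_frame z Dz.
pose G z := perm_mx swap12 *m map_mx conjc (F z) *m perm_mx swap12^-1.
have Gder z v (W : 'M[R[i]]_4) : is_mxcderive z v F (F z *m W) ->
    is_mxcderive z v G (G z *m (perm_mx swap12 *m map_mx conjc W *m perm_mx swap12^-1)).
  move=> FW.
  have cFW : is_mxcderive z v (fun x => map_mx conjc (F x)) (map_mx conjc (F z *m W)).
    move=> i j; rewrite mxE; under eq_fun do rewrite mxE.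
    exact: is_cderive_conj (FW i j).
  have := is_mxcderiveM (is_mxcderiveM (is_mxcderive_cst z v (perm_mx swap12)) cFW)
    (is_mxcderive_cst z v (perm_mx swap12^-1)).
  rewrite mulmx0 addr0 mul0mx add0r swap12V map_mxM /G swap12V.
  by rewrite !mulmxA -(mulmxA _ (perm_mx swap12) (perm_mx swap12)) swap12_mul mulmx1.
have GD : frame_on D W1 W2 G.
  move=> z Dz; have [F1 F2] := FD z Dz.
  have UV := swap12_matV p logb bD Dz; have VU := swap12_matU p logb bD Dz.
  split.
    have := Gder z (1, 0) _ F1.
    by rewrite /W1 map_mxD mulmxDr mulmxDl UV VU addrC.
  have := Gder z (0, 1) _ F2.
  (* The symmetry exchanges [U] and [V], which negates [U - V]; the conjugate of ['i] restores the
     sign. *)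
  have iJ : ('i%C)^*%C = - 'i%C :> R[i].
    by apply/eqP; rewrite eq_complex /= oppr0 !eqxx.
  have iZ (X : 'M[R[i]]_4) : map_mx conjc ('i%C *: X) = - 'i%C *: map_mx conjc X.
    by apply/matrixP => i j; rewrite !mxE conjcM iJ.
  rewrite /W2 iZ map_mxB -scalemxAr -scalemxAl mulmxBr mulmxBl UV VU.
  by rewrite scaleNr -scalerN opprB.
have G0 : G z0 = 1%:M by rewrite /G F0 map_mx1 mulmx1 swap12V swap12_mul.
move=> z Dz; split.
  by rewrite (frame_det oD cD W1tr W2tr FD Dz0 Dz) F0 det1.
exact: (frame_unique oD cD W1tr W2tr Dz0 G0 F0 GD FD).
Qed.

(** * Derivative of the Gauss map and invariance of the metric *)

Lemma mxdz_sandwich z F (J U V : 'M[R[i]]_4) :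
  is_mxcderive z (1, 0) F (F z *m (U + V)) ->
  is_mxcderive z (0, 1) F (F z *m ('i%C *: (U - V))) ->
  mxdz (fun x => F x *m J *m (F x)^T) z = F z *m (U *m J + J *m U^T) *m (F z)^T.
Proof.
have der v (W : 'M[R[i]]_4) : is_mxcderive z v F (F z *m W) ->
    is_mxcderive z v (fun x => F x *m J *m (F x)^T)
      (F z *m (W *m J + J *m W^T) *m (F z)^T).
  move=> FW; have := is_mxcderiveM (is_mxcderiveM FW (is_mxcderive_cst z v J))
    (is_mxcderive_tr FW).
  by rewrite mulmx0 addr0 trmx_mul mulmxDr mulmxDl !mulmxA.
have ii : 'i%C * 'i%C = -1 :> R[i] by rewrite -expr2 sqr_i.
move=> /der F1 /der F2; apply/matrixP => i j; rewrite mxE /dz.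
rewrite (cdir_val (F1 i j)) (cdir_val (F2 i j)).
set g := fun W : 'M[R[i]]_4 => F z *m (W *m J + J *m W^T) *m (F z)^T.
have gD X Y : g (X + Y) = g X + g Y.
  by rewrite /g (raddfD (@trmx _ 4 4)) /= mulmxDl (mulmxDr J) addrACA -mulmxDl -mulmxDr.
have gZ (c : R[i]) (X : 'M[R[i]]_4) : g (c *: X) = c *: g X.
  have tZ : (c *: X)^T = c *: X^T by apply/matrixP => k l; rewrite !mxE.
  by rewrite /g tZ -scalemxAl -scalemxAr -scalerDr -scalemxAr -scalemxAl.
rewrite -[LHS]/((g (U + V) i j - 'i%C * g ('i%C *: (U - V)) i j) / 2) -/(g U).
have gN X : g (- X) = - g X by rewrite -scaleN1r gZ scaleN1r.
(* As [g] is complex linear, the [V] terms cancel and the two [U] terms average to [g U]. *)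
rewrite gZ !gD gN; move: (g U) (g V) => X Y; rewrite !mxE.
by field: ii.
Qed.

(** The inverse of the base point is [H], because [antidiag] is an involution; the outer factors
    then cancel by cyclicity of the trace. *)
Lemma sphere_metric_congr (E X : 'M[R[i]]_4) : E \in unitmx ->
  sphere_metric (E *m antidiag *m E^T) (E *m X *m E^T) (E *m X *m E^T) =
  \tr (antidiag *m X *m antidiag *m X).
Proof.
move=> Eu; pose H := invmx E^T *m antidiag *m invmx E.
have EtV : E^T *m invmx E^T = 1%:M by rewrite mulmxV// unitmx_tr.
have HV : (E *m antidiag *m E^T) *m H = 1%:M.
  rewrite /H !mulmxA -(mulmxA _ E^T) EtV mulmx1.
  by rewrite -(mulmxA E) antidiag_mul mulmx1 mulmxV.
have gV : invmx (E *m antidiag *m E^T) = H.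
  have [gu _] := mulmx1_unit HV.
  by rewrite -[LHS]mulmx1 -HV mulmxA (mulVmx gu) mul1mx.
have HX : H *m (E *m X *m E^T) = invmx E^T *m (antidiag *m X) *m E^T.
  by rewrite /H !mulmxA (mulmxKV Eu).
rewrite /sphere_metric gV HX -mulmxA HX mxtrace_mulC !mulmxA.
by rewrite -(mulmxA _ E^T) EtV mulmx1 mxtrace_mulC !mulmxA EtV mul1mx.
Qed.

End GaussMapFrame.

(** * Values of the Gauss map and the conformality criterion *)

Theorem proposition5p1 (R : realType) (D : set (R * R))
  (D_sc : simply_connected_domain D)
  (sf : R * R -> RP3 R) (sf_imm : immersed_surface D sf)
  (f : R * R -> 'cV[R]_4) (f_lift : lift_on D sf f)
  (z_coord : conformal_coordinate D f)
  (b p : R * R -> R[i]) (f_can : canonical_system D f b p)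
  (metric_pos : positive_definite_projective_metric D f b)
  (logb : R * R -> R[i]) (logbP : log_branch D b logb)
  (z0 : R * R) (Dz0 : D z0)
  (F : R * R -> 'M[R[i]]_4) (F_frame : normalized_frame D b p logb z0 F) :
  (forall z, D z ->
     exists2 Q : 'M[R]_4, sphere_space Q & gauss_map1 F z = complexify Q) /\
  (conformal_map D (gauss_map1 F) <-> demoulin D b p).
Proof.
have [oD cD _] := D_sc; have [bD _ _] := f_can.
have Freal := frame_real oD cD bD Dz0 F_frame.
split=> [z Dz|].
  have [F1 FJ] := Freal z Dz; have NJ := conj_hatF FJ.
  have gJ : map_mx conjc (gauss_map1 F z) = gauss_map1 F z.
    have JJ : map_mx conjc (hatJ1 R) = hatJ1 R.
      by apply/matrixP => i j; rewrite !mxE;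
        case: i => [[|[|[|[|]]]]] //; case: j => [[|[|[|[|]]]]] // ? ?;
        apply/eqP; rewrite eq_complex /= oppr0 !eqxx.
    by rewrite /gauss_map1; move: (hatF F z) NJ => N NJ; rewrite !map_mxM JJ -map_trmx NJ.
  have gQ : gauss_map1 F z = complexify (map_mx (@complex.Re R) (gauss_map1 F z)).
    move: (gauss_map1 F z) gJ => g gJ.
    apply/matrixP => i j; have /matrixP/(_ i j) := gJ.
    rewrite !mxE; case: (g i j) => x y /= [] yy.
    (* An imaginary part equal to its own opposite is zero. *)
    by congr Complex; lra.
  exists (map_mx (@complex.Re R) (gauss_map1 F z)) => //.
  apply: (sphere_space_congr (N := hatF F z)) => //.
  by rewrite /hatF !det_mulmx F1 mulr1 -det_mulmx (mulmxV (matL_unit R)) det1.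
have metricE z : D z ->
    sphere_metric (gauss_map1 F z) (mxdz (gauss_map1 F) z) (mxdz (gauss_map1 F) z) =
    16 * inv_P b p z.
  move=> Dz; have [F1 _] := Freal z Dz.
  have [Fx Fy] := normalized_frame_on F_frame Dz.
  pose E x := matL R *m F x.
  have Eu : E z \in unitmx by rewrite unitmx_mul matL_unit unitmxE F1 unitr1.
  (* The rewriting is done on functions, since [mxdz] differentiates the map and not its value at
     [z]. *)
  have -> : gauss_map1 F = fun x => E x *m antidiag R *m (E x)^T.
    by apply/funext => x; rewrite gauss_map1E.
  (* Left multiplication by a constant preserves the system, so [E] obeys the same equations as
     [F]. *)
  have EW v W : is_mxcderive z v F (F z *m W) -> is_mxcderive z v E (E z *m W).
    move=> FW; have := is_mxcderiveM (is_mxcderive_cst z v (matL R)) FW.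
    by rewrite mul0mx add0r mulmxA.
  rewrite (mxdz_sandwich (antidiag R) (EW _ _ Fx) (EW _ _ Fy)) sphere_metric_congr//.
  have [a [k [c [Q ->]]]] := matUE b p logb z.
  exact: tr_frame_entries.
split=> h z Dz; last by rewrite metricE// h// mulr0.
by have /eqP := h z Dz; rewrite metricE// mulf_eq0 pnatr_eq0 /= => /eqP.
Qed.
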